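(* Every finite groupoid $G$ satisfies $Q^{\mathrm{un}}_G\mathrm{FO}\subsetneq \mathrm{CFL}$.
   Context: CFL denotes the class of $\epsilon$-free context-free languages. Words over a finite ordered alphabet are viewed as finite structures with universe $\{1,\dots,n\}$, unary letter predicates $P_a$, linear order $<$, equality, constants min, max; FO is first-order logic over this signature (without BIT). Unary Lindström quantifier: for a language $L$ over ordered alphabet $(b_1,\dots,b_t)$ and formulas $\phi_1(x),\dots,\phi_{t-1}(x)$, $Q_L x[\phi_1,\dots,\phi_{t-1}]$ holds on $w$ of length $n$ iff the word of length $n$ whose $i$th letter is $b_j$ for the least $j$ with $w\models\phi_j(i)$, and $b_t$ if none, belongs to $L$. A groupoid is a finite set $G$ with an arbitrary binary operation; $\mathcal W(S,G)$, $S\subseteq G$, is the set of nonempty words over alphabet $G$ evaluating into $S$ under some legal bracketing. $Q^{\mathrm{un}}_G\mathrm{FO}$ is the class of languages definable by applying a single unary quantifier $Q_L$ with $L=\mathcal W(S,G)$ for some $S\subseteq G$ to a tuple of FO formulas. *)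

(* Defs.v *)
(* MathComp development, with the reflexive-transitive closure of Stdlib. *)
From Stdlib Require Import Relation_Operators.
From mathcomp Require Import all_boot.

Set Implicit Arguments.
Unset Strict Implicit.
Unset Printing Implicit Defensive.

Definition language (A : Type) := seq A -> Prop.

(* A class ranges over languages over all finite alphabets. *)
Definition language_class := forall A : finType, language A -> Prop.

Definition strict_subclass (C D : language_class) : Prop :=
  (forall (A : finType) (L : language A), C A L -> D A L) /\
  (exists (A : finType) (L : language A), D A L /\ ~ C A L).

Record cfg (A : finType) := Cfg {
  cfg_nonterm : finType;
  cfg_start : cfg_nonterm;
  cfg_prods : seq (cfg_nonterm * seq (cfg_nonterm + A))
}.

Inductive cfg_step (A : finType) (g : cfg A) :
    seq (cfg_nonterm g + A) -> seq (cfg_nonterm g + A) -> Prop :=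
| CfgStep u v X r of (X, r) \in cfg_prods g :
    cfg_step (u ++ inl X :: v) (u ++ r ++ v).

Definition cfg_language (A : finType) (g : cfg A) : language A := fun w =>
  clos_refl_trans _ (@cfg_step A g) [:: inl (cfg_start g)] (map inr w).

Definition CFL : language_class := fun A L =>
  ~ L [::] /\ exists g : cfg A, forall w, L w <-> cfg_language g w.

(* Formulas with free variables in 'I_k.  Under a binder, variable ord0 is the
   bound one and lift ord0 i is the former variable i. *)
Inductive term (k : nat) :=
| Var of 'I_k
| Min
| Max.

Arguments Min {k}.
Arguments Max {k}.

Inductive formula (A : Type) : nat -> Type :=
| Letter k of A & term k : formula A k
| Less k of term k & term k : formula A k
| Equal k of term k & term k : formula A k
| Not k of formula A k : formula A k
| And k of formula A k & formula A k : formula A k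
| Or k of formula A k & formula A k : formula A k
| Exists k of formula A k.+1 : formula A k
| Forall k of formula A k.+1 : formula A k.

(* The structure of a word of length n.+1 has universe 'I_n.+1, i.e. the
   positions 1, ..., n.+1 shifted by one. *)
Definition eval_term (n k : nat) (v : 'I_k -> 'I_n.+1) (t : term k) : 'I_n.+1 :=
  match t with
  | Var i => v i
  | Min => ord0
  | Max => ord_max
  end.

Definition extend (T : Type) (k : nat) (v : 'I_k -> T) (x : T) : 'I_k.+1 -> T :=
  fun i => if unlift ord0 i is Some j then v j else x.

Fixpoint sat (A : finType) (n : nat) (w : n.+1.-tuple A) (k : nat)
    (phi : formula A k) : ('I_k -> 'I_n.+1) -> bool :=
  match phi with
  | Letter _ a t => fun v => tnth w (eval_term v t) == a
  | Less _ s t => fun v => eval_term v s < eval_term v t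
  | Equal _ s t => fun v => eval_term v s == eval_term v t
  | Not _ p => fun v => ~~ sat w p v
  | And _ p q => fun v => sat w p v && sat w q v
  | Or _ p q => fun v => sat w p v || sat w q v
  | Exists _ p => fun v => [exists x, sat w p (extend v x)]
  | Forall _ p => fun v => [forall x, sat w p (extend v x)]
  end.

(* The ordered alphabet is b; [find] returns t when no formula holds, which
   selects the last letter of b. *)
Definition quantifier_word (A : finType) (B : Type) (t : nat)
    (b : t.+1.-tuple B) (phis : t.-tuple (formula A 1))
    (n : nat) (w : n.+1.-tuple A) : n.+1.-tuple B :=
  [tuple tnth b (inord (find (fun phi => sat w phi (fun=> i)) phis)) | i < n.+1].

Definition unary_quantifier (A : finType) (B : Type) (L : language B) (t : nat)
    (b : t.+1.-tuple B) (phis : t.-tuple (formula A 1))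
    (n : nat) (w : n.+1.-tuple A) : Prop :=
  L (quantifier_word b phis w).

Inductive bracketing (G : Type) :=
| Leaf of G
| Node of bracketing G & bracketing G.

Fixpoint yield (G : Type) (s : bracketing G) : seq G :=
  match s with
  | Leaf g => [:: g]
  | Node l r => yield l ++ yield r
  end.

Fixpoint value (G : Type) (op : G -> G -> G) (s : bracketing G) : G :=
  match s with
  | Leaf g => g
  | Node l r => op (value op l) (value op r)
  end.

Definition groupoid_language (G : finType) (op : G -> G -> G) (S : {set G}) :
    language G := fun w =>
  exists s : bracketing G, yield s = w /\ value op s \in S.

(* b lists every element of G exactly once: it is a linear ordering of the
   alphabet G. *)
Definition QunFO (G : finType) (op : G -> G -> G) : language_class := fun A L =>
  ~ L [::] /\
  exists (S : {set G}) (t : nat) (b : t.+1.-tuple G)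
         (phis : t.-tuple (formula A 1)),
    bijective (tnth b) /\
    forall (n : nat) (w : n.+1.-tuple A),
      L w <-> unary_quantifier (groupoid_language op S) b phis w.

(* Main.v *)
(* By an automaton construction for first-order logic, the truth of [phi(i)] in
   a word depends only on the letter at [i], on the state reached by a finite
   automaton on the prefix before [i], and on the state reached by another one
   reading the suffix after [i] backwards.  Hence the word fed to the quantifier
   is produced by a bimachine.  The preimage of [W(S, G)] under a bimachine is
   context-free: annotate each node of a bracketing with its value and with the
   states of both automata at the two ends of its factor.  For strictness,
   consider the words [u ++ rev u] over an alphabet with [#|G| + 1] letters.
   There are more words [u] of a large length [n] than pairs of states and
   words in [G^n], so some [u != u'] give the same output on the left half and
   the same states in the middle; then [u ++ rev u] and [u' ++ rev u] are mapped
   to the same word. *)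
Require Import Defs.
From Stdlib Require Import Relation_Operators.
From mathcomp Require Import all_boot.

Set Implicit Arguments.
Unset Strict Implicit.
Unset Printing Implicit Defensive.

(** * Finite automata on words marked with variable values *)

Section Automata.

Variable A : finType.

(* A letter, two flags for the first and the last position, and the set of
   variables whose value is the position. *)
Definition marked_letter (k : nat) := (A * bool * bool * {set 'I_k})%type.

Definition marks (k : nat) (c : marked_letter k) (t : term k) : bool :=
  match t with
  | Var i => i \in c.2
  | Min => c.1.1.2
  | Max => c.1.2
  end.

Definition marked_at (n k : nat) (w : n.+1.-tuple A) (v : 'I_k -> 'I_n.+1)
    (i : 'I_n.+1) : marked_letter k :=
  (tnth w i, i == ord0, i == ord_max, [set j | v j == i]).

Lemma marks_at n k (w : n.+1.-tuple A) (v : 'I_k -> 'I_n.+1) i t :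
  marks (marked_at w v i) t = (i == eval_term v t).
Proof. by case: t => [j||] //=; rewrite inE eq_sym. Qed.

Definition recognizable (k : nat)
    (R : forall n, n.+1.-tuple A -> ('I_k -> 'I_n.+1) -> bool) : Prop :=
  exists (Q : finType) (q0 : Q) (step : Q -> marked_letter k -> Q)
         (acc : pred Q),
    forall n (w : n.+1.-tuple A) v,
      R n w v = acc (foldl step q0 (map (marked_at w v) (enum 'I_n.+1))).

Lemma eq_recognizable k R R' :
  (forall n w v, R n w v = R' n w v) -> @recognizable k R -> recognizable R'.
Proof.
move=> eqR [Q [q0 [step [acc accP]]]]; exists Q, q0, step, acc => n w v.
by rewrite -eqR.
Qed.

(** Letter and equality atoms take this form, because a term marks exactly the position that is its
    value. *)
Lemma recognizable_has k (p : pred (marked_letter k)) :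
  recognizable (fun n w v => [exists i : 'I_n.+1, p (marked_at w v i)]).
Proof.
exists bool, false, (fun q c => q || p c), id => n w v.
have foldl_has q s : foldl (fun q c => q || p c) q s = q || has p s.
  by elim: s q => [|c s IHs] q /=; rewrite ?orbF // IHs orbA.
rewrite foldl_has has_map /=; apply/existsP/hasP => [[i pi]|[i _ pi]].
  by exists i; rewrite ?mem_enum.
by exists i.
Qed.

Lemma recognizable_less k (s t : term k) :
  recognizable (fun n (w : n.+1.-tuple A) v => eval_term v s < eval_term v t).
Proof.
(* The state records which of [s] and [t] has been met first. *)
pose step (q : option bool) (c : marked_letter k) :=
  if q is Some _ then q else
  if marks c t then Some false else if marks c s then Some true else None.
exists (option bool), None, step, (pred1 (Some true)) => n w v /=.
have stay b l : foldl step (Some b) l = Some b by elim: l.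
rewrite -{1}(index_enum_ord (eval_term v s)) -(index_enum_ord (eval_term v t)).
elim: (enum _) => [|i l IHl] //=; rewrite !marks_at.
case: (i =P eval_term v t) => _; first by rewrite stay ltn0.
by case: eqP => _ //=; rewrite stay.
Qed.

Lemma recognizable_not k R :
  @recognizable k R -> recognizable (fun n w v => ~~ R n w v).
Proof.
case=> Q [q0 [step [acc accP]]].
by exists Q, q0, step, (predC acc) => n w v; rewrite accP.
Qed.

Lemma foldl_pair (T Q1 Q2 : Type) (f1 : Q1 -> T -> Q1) (f2 : Q2 -> T -> Q2)
    (q : Q1 * Q2) s :
  foldl (fun q c => (f1 q.1 c, f2 q.2 c)) q s
    = (foldl f1 q.1 s, foldl f2 q.2 s).
Proof. by elim: s q => [|c s IHs] [q1 q2] //=; rewrite IHs. Qed.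

Lemma foldr_pair (T Q1 Q2 : Type) (f1 : T -> Q1 -> Q1) (f2 : T -> Q2 -> Q2)
    (q : Q1 * Q2) s :
  foldr (fun c q => (f1 c q.1, f2 c q.2)) q s
    = (foldr f1 q.1 s, foldr f2 q.2 s).
Proof. by case: q; elim: s => [|c s IHs] q1 q2 //=; rewrite IHs. Qed.

Lemma recognizable_and k R R' :
  @recognizable k R -> recognizable R' ->
  recognizable (fun n w v => R n w v && R' n w v).
Proof.
case=> Q [q0 [step [acc accP]]] [Q' [q0' [step' [acc' accP']]]].
exists (Q * Q')%type, (q0, q0'), (fun q c => (step q.1 c, step' q.2 c)).
exists (fun q => acc q.1 && acc' q.2) => n w v.
by rewrite accP accP' foldl_pair.
Qed.

Lemma recognizable_or k R R' :
  @recognizable k R -> recognizable R' ->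
  recognizable (fun n w v => R n w v || R' n w v).
Proof.
move=> /recognizable_not recR /recognizable_not recR'.
apply: eq_recognizable (recognizable_not (recognizable_and recR recR')).
by move=> n w v /=; rewrite negb_and !negbK.
Qed.

Definition bind_mark (k : nat) (c : marked_letter k) (b : bool) :
    marked_letter k.+1 :=
  (c.1, [set i | if unlift ord0 i is Some j then j \in c.2 else b]).

Lemma marked_at_extend n k (w : n.+1.-tuple A) (v : 'I_k -> 'I_n.+1) x i :
  marked_at w (extend v x) i = bind_mark (marked_at w v i) (i == x).
Proof.
congr pair; apply/setP => j; rewrite !inE /extend.
by case: unlift => [j'|] /=; rewrite ?inE // eq_sym.
Qed.

Section Projection.

Variables (k : nat) (Q : finType) (step : Q -> marked_letter k.+1 -> Q).

(* The state on the word without the bound variable, and the states on all the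
   words in which it marks one of the positions already read. *)
Definition projection_step (q : Q * {set Q}) (c : marked_letter k) :
    Q * {set Q} :=
  (step q.1 (bind_mark c false),
   step q.1 (bind_mark c true) |: [set step p (bind_mark c false) | p in q.2]).

(** A run kept in the set component either starts in [S] and reads no mark, or leaves the unmarked
    run at one position [i]. Uniqueness of [l] excludes a second mark. *)
Lemma foldl_projectionP (I : eqType) (g : I -> marked_letter k) (l : seq I)
    (q p : Q) (S : {set Q}) : uniq l ->
  reflect
    ((exists2 p0, p0 \in S
        & p = foldl step p0 [seq bind_mark (g j) false | j <- l]) \/
     (exists2 i, i \in l
        & p = foldl step q [seq bind_mark (g j) (j == i) | j <- l]))
    (p \in (foldl projection_step (q, S) (map g l)).2).
Proof.
elim: l q S => [|x l IHl] q S /=.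
  move=> _; apply: (iffP idP) => [pS|[[p0 ? ->]|[i]] //].
  by left; exists p.
case/andP=> xl uniq_l.
have unmarked : [seq bind_mark (g j) (j == x) | j <- l]
    = [seq bind_mark (g j) false | j <- l].
  by apply/eq_in_map => j jl; case: eqP jl xl => // -> ->.
apply: (iffP (IHl _ _ uniq_l)) => [[[p0]|[i il ->]]|[[p0 p0S ->]|[i]]].
- case/setU1P=> [->|/imsetP[p1 p1S ->]] ->; last by left; exists p1.
  by right; exists x; rewrite ?mem_head // eqxx unmarked.
- right; exists i; first by rewrite inE il orbT.
  by case: eqP il xl => // -> ->.
- left; exists (step p0 (bind_mark (g x) false)) => //.
  by rewrite inE imset_f ?orbT.
- rewrite inE; case/predU1P=> [-> ->|il ->].
    left; exists (step q (bind_mark (g x) true)); first by rewrite setU11.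
    by rewrite eqxx unmarked.
  by right; exists i => //; case: eqP il xl => // -> ->.
Qed.

End Projection.

(** Starting from [set0] keeps only the runs with exactly one mark; these correspond to the
    witnesses [x]. *)
Lemma recognizable_exists k R :
  @recognizable k.+1 R ->
  recognizable (fun n w v => [exists x, R n w (extend v x)]).
Proof.
case=> Q [q0 [step [acc accP]]].
exists (Q * {set Q})%type, (q0, set0), (projection_step step).
exists (fun q : Q * {set Q} => [exists p in q.2, acc p]) => n w v.
have markE x : map (marked_at w (extend v x)) (enum 'I_n.+1)
    = [seq bind_mark (marked_at w v i) (i == x) | i <- enum 'I_n.+1].
  by apply: eq_map => i; rewrite marked_at_extend.
apply/existsP/exists_inP => [[x]|[p]].
  rewrite accP markE => acc_p; eexists; last exact: acc_p.
  apply/foldl_projectionP; first exact: enum_uniq.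
  by right; exists x; rewrite ?mem_enum.
case/foldl_projectionP; first exact: enum_uniq; first by case=> p0; rewrite inE.
by case=> x _ -> acc_p; exists x; rewrite accP markE.
Qed.

Lemma recognizable_sat k (phi : formula A k) :
  recognizable (fun n w v => sat w phi v).
Proof.
elim: phi => {k} /=.
- move=> k a t.
  apply: eq_recognizable
    (recognizable_has (fun c => marks c t && (c.1.1.1 == a))) => n w v /=.
  apply/existsP/idP => [[i]|]; first by rewrite marks_at => /andP[/eqP->].
  by exists (eval_term v t); rewrite marks_at eqxx.
- by move=> k s t; apply: recognizable_less.
- move=> k s t.
  apply: eq_recognizable
    (recognizable_has (fun c => marks c s && marks c t)) => n w v /=.
  apply/existsP/eqP => [[i]|eq_st].
    by rewrite !marks_at => /andP[/eqP<- /eqP<-].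
  by exists (eval_term v t); rewrite !marks_at eq_st eqxx.
- by move=> k p; apply: recognizable_not.
- by move=> k p recp q; apply: recognizable_and.
- by move=> k p recp q; apply: recognizable_or.
- by move=> k p; apply: recognizable_exists.
- move=> k p /recognizable_not/recognizable_exists/recognizable_not.
  apply: eq_recognizable => n w v /=; rewrite negb_exists.
  by apply: eq_forallb => x; rewrite negbK.
Qed.

End Automata.

(** * Bimachines and their outputs *)

Record bimachine (A B : Type) := Bimachine {
  left_state : finType;
  right_state : finType;
  left_init : left_state;
  right_init : right_state;
  left_step : left_state -> A -> left_state;
  right_step : A -> right_state -> right_state;
  local_output : left_state -> A -> right_state -> B
}.

Section Bimachine.

Variables (A B : Type) (M : bimachine A B).

Notation left_run := (foldl (@left_step _ _ M)).
Notation right_run := (foldr (@right_step _ _ M)).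

Fixpoint output (q : left_state M) (p : right_state M) (s : seq A) : seq B :=
  if s is a :: s' then
    local_output q a (right_run p s') :: output (left_step q a) p s'
  else [::].

(** A factor sees its context only through the two states at its ends; the grammar and the collision
    below both rest on this. *)
Lemma output_cat q p s1 s2 :
  output q p (s1 ++ s2)
    = output q (right_run p s2) s1 ++ output (left_run q s1) p s2.
Proof. by elim: s1 q => [|a s1 IHs] q //=; rewrite IHs foldr_cat. Qed.

Lemma size_output q p s : size (output q p s) = size s.
Proof. by elim: s q => [|a s IHs] q //=; rewrite IHs. Qed.

Definition output_at (a : A) (s : seq A) (i : nat) : B :=
  local_output (left_run (left_init M) (take i s)) a
    (right_run (right_init M) (drop i.+1 s)).

Lemma nth_output b0 a0 s i : i < size s ->
  nth b0 (output (left_init M) (right_init M) s) i = output_at (nth a0 s i) s i.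
Proof.
rewrite /output_at; elim: s i (left_init M) => [|a s IHs] [|i] q //=.
  by rewrite drop0.
exact: IHs.
Qed.

End Bimachine.

(** * From first-order formulas to bimachines *)

Section FirstOrderBimachine.

Variable A : finType.

(** Read backwards, a suffix is summarized by the set of states from which the automaton accepts it.
    The formula holds at [i] when the state reached after position [i] lies in this set. *)
Lemma sat_bimachine (phi : formula A 1) :
  exists M : bimachine A bool, forall n (w : n.+1.-tuple A) (i : 'I_n.+1),
    output_at M (tnth w i) w i = sat w phi (fun=> i).
Proof.
have [Q [q0 [step [acc accP]]]] := recognizable_sat phi.
(* The flag of a state tells whether nothing has been read yet. *)
pose lstep (q : bool * Q) a := (false, step q.2 (a, q.1, false, set0)).
pose rstep a (p : bool * {set Q}) :=
  (false, [set q | step q (a, false, p.1, set0) \in p.2]).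
(* [setT] marks position [i] with the only variable; all other positions carry [set0]. *)
pose out (q : bool * Q) a (p : bool * {set Q}) :=
  step q.2 (a, q.1, p.1, setT) \in p.2.
exists (Bimachine (true, q0) (true, [set q | acc q]) lstep rstep out) => n w i.
rewrite accP /output_at /=; set a0 := tnth w i.
pose F j : marked_letter A 1 :=
  (nth a0 w j, j == 0, j == n, if j == i then setT else set0).
have -> : map (marked_at w (fun=> i)) (enum 'I_n.+1) = map F (iota 0 n.+1).
  rewrite -val_enum_ord -map_comp; apply: eq_map => j.
  rewrite /F /marked_at /= (tnth_nth a0); congr (_, _, _, _).
  by apply/setP => x; rewrite inE eq_sym -val_eqE /=; case: eqP; rewrite inE.
have size_w : size w = n.+1 by rewrite size_tuple.
(* Positions before [i] are neither last nor marked, and those after [i] neither first nor marked,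
   which justifies the constants in [lstep] and [rstep]. *)
have leftE m : m <= i -> foldl lstep (true, q0) (take m w)
    = (m == 0, foldl step q0 (map F (iota 0 m))).
  elim: m => [|m IHm] ltmi; first by rewrite take0.
  have ltmn := leq_trans ltmi (ltnW (ltn_ord i)).
  rewrite (take_nth a0) ?size_w // -cats1 foldl_cat IHm 1?ltnW //.
  have ltmn' : m < n by apply: leq_trans ltmi _; rewrite -ltnS.
  have -> : iota 0 m.+1 = iota 0 m ++ [:: m].
    by rewrite -addn1 iotaD.
  by rewrite map_cat foldl_cat /= /lstep /F /= (ltn_eqF ltmi) (ltn_eqF ltmn').
have rightE d m : i < m -> m + d = n.+1 ->
    foldr rstep (true, [set q | acc q]) (drop m w)
    = (d == 0, [set q | acc (foldl step q (map F (iota m d)))]).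
  elim: d m => [|d IHd] m ltim eqn.
    by rewrite drop_oversize ?size_w -?eqn ?addn0.
  have ltmn : m < n.+1 by rewrite -eqn -addSnnS leq_addr.
  rewrite (drop_nth a0) ?size_w //= (IHd m.+1) ?addSnnS //; last exact: ltnW.
  congr (_, _); apply/setP => q; rewrite !inE /F.
  rewrite (gtn_eqF ltim) (gtn_eqF (leq_ltn_trans (leq0n i) ltim)).
  suff -> : (m == n) = (d == 0) by [].
  by move: eqn; rewrite addnS => -[<-]; rewrite -{1}[m]addn0 eqn_add2l eq_sym.
have ltin := ltn_ord i.
rewrite leftE // (rightE (n - i)) //; last by rewrite addSn subnKC.
have -> : iota 0 n.+1 = iota 0 i ++ val i :: iota i.+1 (n - i).
  by rewrite -[_ :: _]/(iota i (n - i).+1) -iotaD addnS subnKC.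
rewrite map_cat foldl_cat /= /out inE /= /F eqxx.
rewrite -(tnth_nth a0 w i) subn_eq0 [val i == n]eqn_leq -(ltnS i n) ltin.
by [].
Qed.

(** A product of bimachines, one per formula, whose local output follows the recursion of [find]. *)
Lemma find_bimachine (phis : seq (formula A 1)) :
  exists M : bimachine A nat, forall n (w : n.+1.-tuple A) (i : 'I_n.+1),
    output_at M (tnth w i) w i = find (fun phi => sat w phi (fun=> i)) phis.
Proof.
elim: phis => [|phi phis [M2 M2P]].
  by exists (Bimachine tt tt (fun _ _ => tt) (fun _ _ => tt) (fun _ _ _ => 0)).
have [M1 M1P] := sat_bimachine phi.
exists (Bimachine (left_init M1, left_init M2) (right_init M1, right_init M2)
  (fun q a => (left_step q.1 a, left_step q.2 a))
  (fun a p => (right_step a p.1, right_step a p.2))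
  (fun q a p => if local_output q.1 a p.1 then 0
                else (local_output q.2 a p.2).+1)) => n w i.
rewrite /= -M1P -M2P /output_at /=.
by rewrite (foldl_pair (@left_step _ _ M1) (@left_step _ _ M2))
  (foldr_pair (@right_step _ _ M1) (@right_step _ _ M2)).
Qed.

Lemma quantifier_word_bimachine (B : Type) (t : nat) (b : t.+1.-tuple B)
    (phis : t.-tuple (formula A 1)) :
  exists M : bimachine A B, forall n (w : n.+1.-tuple A),
    quantifier_word b phis w = output (left_init M) (right_init M) w :> seq B.
Proof.
have [M0 M0P] := find_bimachine phis.
pose M := Bimachine (left_init M0) (right_init M0) (@left_step _ _ M0)
  (@right_step _ _ M0) (fun q a p => tnth b (inord (local_output q a p))).
exists M => n w; have b0 := thead b.
apply: (@eq_from_nth _ b0) => [|i]; first by rewrite size_output !size_tuple.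
rewrite size_tuple => ltin; pose j := Ordinal ltin.
rewrite (nth_output M b0 (thead w)) ?size_tuple //.
rewrite -(tnth_nth b0 (quantifier_word b phis w) j) tnth_mktuple -M0P.
by rewrite (tnth_nth (thead w)).
Qed.

End FirstOrderBimachine.

(** * Derivations and interpretations of grammars *)

Section ContextFree.

Variables (A : finType) (g : cfg A).

Notation form := (seq (cfg_nonterm g + A)).

Definition derives : form -> form -> Prop := clos_refl_trans _ (@cfg_step A g).

Lemma derives_context (u v s s' : form) :
  derives s s' -> derives (u ++ s ++ v) (u ++ s' ++ v).
Proof.
elim=> {s s'} [s s' []|s|s1 s2 s3 _ d12 _ d23]; last exact: rt_trans d12 d23.
  move=> u' v' X r Xr; apply: rt_step.
  by have := CfgStep (u ++ u') (v' ++ v) Xr; rewrite -!catA.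
exact: rt_refl.
Qed.

Lemma derives_cat (s1 s1' s2 s2' : form) :
  derives s1 s1' -> derives s2 s2' -> derives (s1 ++ s2) (s1' ++ s2').
Proof.
move=> /(derives_context [::] s2) d1 /(derives_context s1' [::]).
by rewrite !cats0; apply: rt_trans.
Qed.

Lemma derives_prod X r (s : form) :
  (X, r) \in cfg_prods g -> derives r s -> derives [:: inl X] s.
Proof.
move=> Xr; apply: rt_trans; apply: rt_step.
by have := CfgStep [::] [::] Xr; rewrite cats0.
Qed.

Variable I : cfg_nonterm g -> seq A -> Prop.

Fixpoint form_language (s : form) (w : seq A) : Prop :=
  match s with
  | [::] => w = [::]
  | inl X :: s' => exists u v, [/\ w = u ++ v, I X u & form_language s' v]
  | inr a :: s' => exists2 v, w = a :: v & form_language s' v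
  end.

Lemma form_language_cat s1 s2 w :
  form_language (s1 ++ s2) w <->
  exists u v, [/\ w = u ++ v, form_language s1 u & form_language s2 v].
Proof.
elim: s1 w => [|[X|a] s1 IHs] w /=.
- by split=> [|[u [v [-> -> ?]]] //]; exists [::], w.
- split=> [[u [v [-> Xu /IHs[u' [v' [-> s1u s2v]]]]]]|].
    by exists (u ++ u'), v'; rewrite catA; split=> //; exists u, u'.
  case=> _ [v [-> [u [u' [-> Xu s1u]]] s2v]].
  by exists u, (u' ++ v); rewrite catA; split=> //; apply/IHs; exists u', v.
- split=> [[_ -> /IHs[u [v [-> s1u s2v]]]]|].
    by exists (a :: u), v; split=> //; exists u.
  case=> _ [v [-> [u -> s1u] s2v]].
  by exists (u ++ v) => //; apply/IHs; exists u, v.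
Qed.

Hypothesis I_closed : forall X r w,
  (X, r) \in cfg_prods g -> form_language r w -> I X w.

(** By closure, the language of a sentential form can only shrink along a derivation, and a terminal
    word belongs to its own language. Soundness of a grammar thus reduces to checking its
    productions. *)
Lemma cfg_language_sub w : cfg_language g w -> I (cfg_start g) w.
Proof.
have wW : form_language (map inr w) w by elim: w => //= a w IHw; exists w.
have sound s s' : derives s s' ->
    forall v, form_language s' v -> form_language s v.
  elim=> {s s'} [_ _ [u v X r Xr] w'|//|s1 s2 s3 _ IH12 _ IH23 v /IH23/IH12 //].
  case/form_language_cat=> w1 [w23 [-> s1]].
  case/form_language_cat=> w2 [w3 [-> s2 s3]].
  apply/form_language_cat; exists w1, (w2 ++ w3); split=> //=.
  by exists w2, w3; split=> //; apply: I_closed Xr s2.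
by move=> /sound/(_ w wW)[u [v [-> Iu ->]]]; rewrite cats0.
Qed.

End ContextFree.

(** * Context-free preimages of groupoid languages *)

Lemma yield_nonempty (G : Type) (s : bracketing G) : yield s <> [::].
Proof. by elim: s => //= l; case: (yield l). Qed.

Lemma bimachine_groupoid_CFL (A G : finType) (op : G -> G -> G) (S : {set G})
    (M : bimachine A G) :
  CFL (fun w => groupoid_language op S (output (left_init M) (right_init M) w)).
Proof.
pose q0 := left_init M; pose p0 := right_init M.
pose Ql := left_state M; pose Qr := right_state M.
(* [Some (q, q', p', p, x)] generates the words that take the left automaton
   from [q] to [q'] and the right one from [p] to [p'], and whose output between
   [q] and [p] can be evaluated to [x]. *)
pose N : finType := option (Ql * Ql * Qr * Qr * G).
(* The states at the far ends are left free; indexing by a subtype restricts the value to [S] and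
   stays finite. *)
pose startp (y : Ql * Qr * {x | x \in S}) : N * seq (N + A) :=
  let: (q, p, x) := y in (None, [:: inl (Some (q0, q, p, p0, val x))]).
pose leafp (y : Ql * A * Qr) : N * seq (N + A) :=
  let: (q, a, p) := y in
  (Some (q, left_step q a, right_step a p, p, local_output q a p), [:: inr a]).
pose nodep (y : Ql * Ql * Ql * Qr * Qr * Qr * G * G) : N * seq (N + A) :=
  let: (q1, q2, q3, p1, p2, p3, x, x') := y in
  (Some (q1, q3, p1, p3, op x x'),
   [:: inl (Some (q1, q2, p1, p2, x)); inl (Some (q2, q3, p2, p3, x'))]).
pose g := @Cfg A N None (codom startp ++ codom leafp ++ codom nodep).
split; first by case=> s [/yield_nonempty].
exists g => w; split.
- pose leftS (q : Ql) u := foldl (@left_step _ _ M) q u.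
  pose rightS (p : Qr) u := foldr (@right_step _ _ M) p u.
  have complete (s : bracketing G) q p u : yield s = output q p u ->
      derives (g := g)
        [:: inl (Some (q, leftS q u, rightS p u, p, value op s))] (map inr u).
    elim: s q p u => [x|l IHl r IHr] q p u /=.
      case: u => [|a []] //= [->].
      apply: (@derives_prod A g _ [:: inr a]); last exact: rt_refl.
      by rewrite !mem_cat (codom_f leafp (q, a, p)) orbT.
    (* Outputs keep lengths, so the left subtree yields the output of the prefix of length [m]. *)
    move=> eq_u; pose m := size (yield l).
    have size_u : size u = m + size (yield r).
      by rewrite -(size_output q p) -eq_u size_cat.
    move: eq_u; rewrite -{1}[u](cat_take_drop m) output_cat => /eqP.
    rewrite eqseq_cat ?size_output ?size_takel ?size_u ?leq_addr //.
    case/andP=> /eqP/IHl dl /eqP/IHr dr.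
    rewrite -[u](cat_take_drop m) map_cat /leftS /rightS foldl_cat foldr_cat.
    apply: derives_prod (derives_cat dl dr).
    by rewrite !mem_cat (codom_f nodep (_, _, _, _, _, _, _, _)) !orbT.
  case=> s [ys Ss].
  apply: derives_prod (complete s q0 p0 w ys).
  by rewrite mem_cat (codom_f startp (_, _, exist (fun x => x \in S) _ Ss)).
(* The intended language of each nonterminal, to be checked against the three families of
   productions. *)
- pose I (X : N) u := if X is Some (q, q', p', p, x) then
    [/\ foldl (@left_step _ _ M) q u = q', foldr (@right_step _ _ M) p u = p' &
      exists2 s, yield s = output q p u & value op s = x]
    else groupoid_language op S (output q0 p0 u).
  apply: (@cfg_language_sub A g I) => X r u.
  rewrite !mem_cat => /or3P[] /codomP[].
  + case=> [[q p] [x Sx]] [-> ->] [u' [_ [-> [_ _ [s ys vs]] ->]]].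
    by rewrite cats0; exists s; rewrite vs.
  + case=> [[q a] p] [-> ->] [_ -> ->] /=; split=> //.
    by exists (Leaf (local_output q a p)).
  + case=> [[[[[[[q1 q2] q3] p1] p2] p3] x] x'] [-> ->].
    case=> u1 [_ [-> [<- p2E [s1 ys1 <-]]
      [u2 [_ [-> [<- p3E [s2 ys2 <-]] ->]]]]].
    rewrite cats0 /= foldl_cat foldr_cat p3E; split=> //.
    by exists (Node s1 s2); rewrite //= output_cat p3E ys1 ys2.
Qed.

(** * Even palindromes, the separating language *)

Definition even_palindromes (A : Type) : language A := fun w =>
  exists2 u, u <> [::] & w = u ++ rev u.

Lemma even_palindromes_CFL (A : finType) : CFL (@even_palindromes A).
Proof.
(* Recursion ends with two letters, not with the empty word, since [CFL] is epsilon-free. *)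
pose basep (a : A) : unit * seq (unit + A) := (tt, [:: inr a; inr a]).
pose stepp (a : A) : unit * seq (unit + A) := (tt, [:: inr a; inl tt; inr a]).
pose g := @Cfg A unit tt (codom basep ++ codom stepp).
split; first by case=> -[].
exists g => w; split=> [[u + ->]|].
- have complete a v :
      derives (g := g) [:: inl tt] (map inr ((a :: v) ++ rev (a :: v))).
    elim: v a => [|b v IHv] a.
      apply: (@derives_prod A g _ [:: inr a; inr a]); last exact: rt_refl.
      by rewrite mem_cat (codom_f basep a).
    apply: (@derives_prod A g _ [:: inr a; inl tt; inr a]).
      by rewrite mem_cat (codom_f stepp a) orbT.
    rewrite rev_cons -cats1 catA /= map_cat.
    exact: (derives_context [:: inr a] [:: inr a] (IHv b)).
  by case: u => // a v _; apply: complete.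
- apply: (@cfg_language_sub A g (fun=> @even_palindromes A)) => X r v.
  rewrite mem_cat => /orP[] /codomP[a [_ ->]] /=.
    by case=> _ -> [_ -> ->]; exists [:: a].
  case=> _ -> [u' [_ [-> [u _ ->] [_ -> ->]]]].
  by exists (a :: u); rewrite // rev_cons -cats1 /= -!catA.
Qed.

(** * Counting and the pigeonhole argument *)

Lemma exp_ltn_mul_expS (C m : nat) : exists n, C * m ^ n < m.+1 ^ n.
Proof.
case: m => [|m]; first by exists 1; rewrite muln0.
(* Bernoulli's inequality for [1 + 1 / m.+1], cleared of denominators. *)
have bernoulli n : m.+1 ^ n * (m.+1 + n) <= m.+1 * m.+2 ^ n.
  elim: n => [|n IHn]; first by rewrite !expn0 addn0 mul1n muln1.
  rewrite !expnS [m.+2 * _]mulnC mulnA.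
  apply: leq_trans (leq_mul IHn (leqnn m.+2)).
  rewrite -[leqRHS]mulnA [m.+1 * _]mulnC -mulnA leq_mul2l.
  apply/orP; right.
  rewrite addnS mulnS [leqRHS]mulnS [leqRHS]addnC mulnC addnC.
  by rewrite leq_add2l leq_addr.
(* With this exponent [m.+1 + n] exceeds [C * m.+1] by the positive term [m.+1], so the inequality
   is strict. *)
exists (C * m.+1).
rewrite -(ltn_pmul2l (ltn0Sn m)); apply: leq_trans (bernoulli _).
rewrite mulnDr mulnA [m.+1 * C]mulnC [_ * (C * _)]mulnC.
by rewrite -[X in X < _]add0n ltn_add2r muln_gt0 expn_gt0.
Qed.

(** The input alphabet has one letter more than the output alphabet, so for large [n] a constant
    number of state pairs cannot keep all words of length [n] apart. *)
Lemma bimachine_palindrome_collision (G : finType)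
    (M : bimachine (option G) G) :
  exists u v : seq (option G), [/\ u <> [::], size u = size v, u <> v &
    output (left_init M) (right_init M) (v ++ rev u)
      = output (left_init M) (right_init M) (u ++ rev u)].
Proof.
pose q0 := left_init M; pose p0 := right_init M.
have [n ltn_exp] :=
  exp_ltn_mul_expS (#|left_state M| * #|right_state M|) #|G|.
pose middle (u : seq (option G)) := foldr (@right_step _ _ M) p0 (rev u).
have size_left (u : n.-tuple (option G)) : size (output q0 (middle u) u) == n.
  by rewrite size_output size_tuple.
pose f (u : n.-tuple (option G)) :=
  (foldl (@left_step _ _ M) q0 u, middle u, Tuple (size_left u)).
have /injectivePn[u [v /eqP neq_uv eq_f]] : ~~ injectiveb f.
  apply/negP => /injectiveP/leq_card.
  by rewrite !card_prod !card_tuple card_option leqNgt ltn_exp.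
have [eq_left eq_mid eq_out] := eq_f.
exists u, v; split; rewrite ?size_tuple //.
- move=> u0; apply: neq_uv; apply: val_inj; rewrite /= u0; apply/esym/size0nil.
  by rewrite size_tuple -(size_tuple u) u0.
- by move/val_inj.
(* In [v ++ rev u] the left half is read against the right state of [rev u], which is also that of
   [rev v]. *)
- by rewrite !output_cat -/(middle u) [in LHS]eq_mid -eq_out -eq_left.
Qed.

Theorem theorem19 (G : finType) (op : G -> G -> G) :
  strict_subclass (QunFO op) CFL.
Proof.
split=> [A L [L0 [S [t [b [phis [_ LP]]]]]]|].
  split=> //.
  have [M MP] := quantifier_word_bimachine b phis.
  have [GL0 [g gP]] := bimachine_groupoid_CFL op S M.
  (* Formulas only see nonempty words; the empty word lies in neither language. *)
  exists g => -[|a w]; first by split=> // /gP/GL0.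
  apply: (iff_trans (LP _ (in_tuple (a :: w)))).
  by rewrite /unary_quantifier MP; apply: gP.
exists (option G), (@even_palindromes (option G)).
split; first exact: even_palindromes_CFL.
case=> _ [S [t [b [phis [_ LP]]]]].
have [M MP] := quantifier_word_bimachine b phis.
have [u [v [u0 size_uv neq_uv eq_out]]] := bimachine_palindrome_collision M.
have palP w : w <> [::] -> even_palindromes w <->
    groupoid_language op S (output (left_init M) (right_init M) w).
  case: w => // a w _.
  by have := LP _ (in_tuple (a :: w)); rewrite /unary_quantifier MP.
have : even_palindromes (v ++ rev u).
  apply/palP; first by case: v size_uv {neq_uv eq_out} => //; case: u u0.
  by rewrite eq_out; apply/palP; [case: (u) u0 | exists u].
case=> x _ eq_x; have : rev (v ++ rev u) = v ++ rev u.
  by rewrite eq_x rev_cat revK.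
(* The reversal is [u ++ rev v]; as the sizes agree, comparing prefixes gives [u = v]. *)
rewrite rev_cat revK => /eqP; rewrite eqseq_cat // => /andP[/eqP/neq_uv] //.
Qed.
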